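(* For every $n$-HCFP $\mathcal{H}$ and every regular set $S$ of $n$-stores, the set $\mathit{pre}^*_{\mathcal{H}}(S)$ is regular, and a finite automaton (equivalently, a nested store automaton) recognizing it is effectively computable from $\mathcal{H}$ and a finite automaton recognizing $S$.
   Context: Higher-order stores over a finite alphabet $\Gamma$: a 1-store is a sequence $[a_1\ldots a_l]$, $a_i\in\Gamma$, $l\ge0$; for $n\ge2$ an $n$-store is a nonempty sequence $[s_1\ldots s_l]$ of $(n-1)$-stores. An $n$-store is identified with its word $w(s)=[w(s_1)\ldots w(s_l)]$ over $\Gamma'=\Gamma\cup\{[,]\}$; a set of $n$-stores is regular if its set of words is accepted by a finite automaton over $\Gamma'$. Operations: on 1-stores, $\mathit{push}_1^w([a_1\ldots a_l])=[w a_2\ldots a_l]$ for $w\in\Gamma^*$ and $\mathit{top}_1([a_1\ldots a_l])=a_1$ (defined only when $l\ge1$). On $n$-stores $s=[s_1\ldots s_l]$, $n>1$: $\mathit{push}_1^w(s)=[\mathit{push}_1^w(s_1)\,s_2\ldots s_l]$; for $2\le k<n$, $\mathit{push}_k(s)=[\mathit{push}_k(s_1)\,s_2\ldots s_l]$ and $\mathit{pop}_k(s)=[\mathit{pop}_k(s_1)\,s_2\ldots s_l]$; $\mathit{push}_n(s)=[s_1 s_1 s_2\ldots s_l]$; $\mathit{pop}_n(s)=[s_2\ldots s_l]$ if $l>1$, undefined otherwise; $\mathit{top}_k(s)=\mathit{top}_k(s_1)$ for $k<n$, $\mathit{top}_n(s)=s_1$. $O_n=\{\mathit{push}_k,\mathit{pop}_k\mid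 k\in[2,n]\}\cup\{\mathit{push}_1^w\mid w\in\Gamma^*\}$. An $n$-HCFP is $\mathcal{H}=(\Gamma,\Delta)$ with $\Delta\subseteq\Gamma\times O_n$ finite; configurations are $n$-stores, and $s\hookrightarrow s'$ iff there is $(a,o)\in\Delta$ with $\mathit{top}_1(s)=a$ and $s'=o(s)$ (defined). $\overset{*}{\hookrightarrow}$ is the reflexive-transitive closure of $\hookrightarrow$, and $\mathit{pre}^*_{\mathcal{H}}(S)=\{s\mid\exists s'\in S,\ s\overset{*}{\hookrightarrow}s'\}$. *)

(* Defs.v *)
From Stdlib Require List.
From mathcomp Require Import all_boot.
Set Implicit Arguments. Unset Strict Implicit. Unset Printing Implicit Defensive.

Record nfa (Sig : finType) := NFA {
  nfa_size : nat;
  nfa_init : {set 'I_nfa_size};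
  nfa_final : {set 'I_nfa_size};
  nfa_trans : 'I_nfa_size -> Sig -> {set 'I_nfa_size} }.

Definition nfa_step (Sig : finType) (A : nfa Sig) (X : {set 'I_(nfa_size A)}) (c : Sig)
  : {set 'I_(nfa_size A)} :=
  [set q' | [exists q in X, q' \in nfa_trans q c]].

Definition nfa_accepts (Sig : finType) (A : nfa Sig) (w : seq Sig) : bool :=
  [exists q in foldl (nfa_step (A:=A)) (nfa_init A) w, q \in nfa_final A].

(* inl a = letter a, inr true = '[', inr false = ']' *)
Definition salph (G : finType) : finType := (G + bool)%type.
Definition LB (G : finType) : salph G := inr true.
Definition RB (G : finType) : salph G := inr false.

Inductive store (G : Type) :=
| S1 of seq G            (* 1-store [a_1 ... a_l] (a_1 is the top) *)
| Sn of seq (store G).   (* k-store [s_1 ... s_l], k >= 2 (s_1 is the top) *)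
Arguments S1 {G}. Arguments Sn {G}.

Fixpoint is_store (G : Type) (n : nat) (s : store G) : Prop :=
  match n, s with
  | 1, S1 _ => True
  | m.+2, Sn l => l <> [::] /\
      (fix all_st (l : seq (store G)) : Prop :=
         match l with [::] => True | t :: r => is_store m.+1 t /\ all_st r end) l
  | _, _ => False
  end.

Fixpoint sword (G : finType) (s : store G) : seq (salph G) :=
  match s with
  | S1 w => LB G :: rcons (map inl w) (RB G)
  | Sn l => LB G :: rcons
      ((fix fl (l : seq (store G)) : seq (salph G) :=
          match l with [::] => [::] | t :: r => sword t ++ fl r end) l) (RB G)
  end.

Inductive op (G : Type) :=
| Push1 of seq G
| Push of nat
| Pop of nat.
Arguments Push1 {G}. Arguments Push {G}. Arguments Pop {G}.

Fixpoint top1 (G : Type) (s : store G) : option G :=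
  match s with
  | S1 (a :: _) => Some a
  | Sn (t :: _) => top1 t
  | _ => None
  end.

Fixpoint push1 (G : Type) (w : seq G) (s : store G) : option (store G) :=
  match s with
  | S1 (_ :: l) => Some (S1 (w ++ l))
  | Sn (t :: r) => omap (fun t' => Sn (t' :: r)) (push1 w t)
  | _ => None
  end.

(* push_k / pop_k applied to an m-store *)
Fixpoint pushk (G : Type) (k m : nat) (s : store G) : option (store G) :=
  match m with
  | 0 => None
  | m'.+1 =>
    if k == m then
      match s with Sn (t :: r) => Some (Sn (t :: t :: r)) | _ => None end
    else
      match s with Sn (t :: r) => omap (fun t' => Sn (t' :: r)) (pushk k m' t)
                 | _ => None end
  end.

Fixpoint popk (G : Type) (k m : nat) (s : store G) : option (store G) :=
  match m with
  | 0 => None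
  | m'.+1 =>
    if k == m then
      match s with Sn (_ :: t2 :: r) => Some (Sn (t2 :: r)) | _ => None end
    else
      match s with Sn (t :: r) => omap (fun t' => Sn (t' :: r)) (popk k m' t)
                 | _ => None end
  end.

Definition apply_op (G : Type) (n : nat) (o : op G) (s : store G) : option (store G) :=
  match o with
  | Push1 w => push1 w s
  | Push k => pushk k n s
  | Pop k => popk k n s
  end.

(* An n-HCFP (Gamma, Delta): Delta is a finite set, given as a list, of pairs (a, o)
   with o in O_n, i.e. the level k of push_k/pop_k lies in [2, n]. *)
Definition op_in_On (G : Type) (n : nat) (o : op G) : bool :=
  match o with
  | Push1 _ => true
  | Push k | Pop k => (2 <= k <= n)
  end.

Definition hcfp (G : Type) := seq (G * op G).

Definition hcfp_wf (G : Type) (n : nat) (H : hcfp G) : Prop :=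
  forall a o, List.In (a, o) H -> op_in_On n o.

Definition hstep (G : Type) (n : nat) (H : hcfp G) (s s' : store G) : Prop :=
  exists a o, List.In (a, o) H /\ top1 s = Some a /\ apply_op n o s = Some s'.

Inductive hreach (G : Type) (n : nat) (H : hcfp G) : store G -> store G -> Prop :=
| hreach_refl s : hreach n H s s
| hreach_step s s' s'' : hstep n H s s' -> hreach n H s' s'' -> hreach n H s s''.

Definition pre_star (G : Type) (n : nat) (H : hcfp G) (S : store G -> Prop)
  (s : store G) : Prop :=
  is_store n s /\ exists s', S s' /\ hreach n H s s'.

Definition stores_of (G : finType) (n : nat) (A : nfa (salph G)) (s : store G) : Prop :=
  is_store n s /\ nfa_accepts A (sword s).

(* Main.v *)
(** A store is seen as an item on top of the sequence of the items below it, and the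
    condition to reach [S] is generalised to alternating systems with several control
    states, i.e. to a least family [X_p] of sets of stores. Whether [X_p] contains
    [u :: l] depends on [l] only through its type: the behaviour of the word of [l] on
    the automaton of [S], together with the set of controls [q] such that [X_q]
    contains [l]. So an [n]-system over stores [u :: l] is an [(n-1)]-system over [u]
    with pairs (control, type) as controls: a pop at level [n] tests membership in the
    type, and a push at level [n] guesses the type of [u :: l] and verifies it by
    alternation, running the guessed controls on [u] itself. At level 1 the items are
    letters and the family is a least fixpoint in a finite powerset. The types of
    stores are then computed by a finite automaton reading words from right to left. *)
Require Import Defs.
From Stdlib Require List.
From mathcomp Require Import all_boot.
Set Implicit Arguments. Unset Strict Implicit. Unset Printing Implicit Defensive.

(** * Machines reading words from right to left *)

Record machine (Sig O : finType) := Machine {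
  mstate : finType;
  mstart : mstate;
  mstep : Sig -> mstate -> mstate;
  mout : mstate -> option O }.

Definition mrun (Sig O : finType) (B : machine Sig O) (w : seq Sig) : mstate B :=
  foldr (mstep (m:=B)) (mstart B) w.

Record recognizes (Sig O : finType) (U : Type) (valid : U -> Prop)
    (word : U -> seq Sig) (val : U -> O) (B : machine Sig O) : Prop := {
  rec_complete u : valid u -> mout (mrun B (word u)) = Some (val u);
  rec_sound w o : mout (mrun B w) = Some o -> exists2 u, valid u & w = word u;
  (* Accepted words form a suffix code, which lets a machine for lists of items
     detect where each item begins. *)
  rec_code (d : mstate B) c w : mout d -> mout (foldr (mstep (m:=B)) (mstep c d) w) = None }.

(** Reversal: [mrun] starts at the right end of the word, where the run of the nfa ends. *)
Definition machine_nfa (Sig O : finType) (B : machine Sig O) (F : pred O) : nfa Sig :=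
  @NFA Sig #|mstate B|
    [set i | if mout (enum_val i) is Some o then F o else false]
    [set enum_rank (mstart B)]
    (fun i c => [set j | mstep c (enum_val j) == enum_val i]).

Lemma machine_nfaP (Sig O : finType) (B : machine Sig O) (F : pred O) w :
  nfa_accepts (machine_nfa B F) w = (if mout (mrun B w) is Some o then F o else false).
Proof.
have run (X : {set 'I_(nfa_size (machine_nfa B F))}) :
    [exists q in foldl (nfa_step (A:=machine_nfa B F)) X w, q \in nfa_final (machine_nfa B F)]
      = (enum_rank (mrun B w) \in X).
  elim: w X => [|c w IH] X /=.
    apply/existsP/idP => [[q /andP[qX]]|sX]; first by rewrite inE => /eqP <-.
    by exists (enum_rank (mstart B)); rewrite sX inE eqxx.
  rewrite IH inE; apply/existsP/idP => [[q /andP[qX]]|sX].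
    by rewrite inE enum_rankK => /eqP ->; rewrite enum_valK.
  by exists (enum_rank (mrun B (c :: w))); rewrite sX inE !enum_rankK /=.
by rewrite /nfa_accepts run inE enum_rankK.
Qed.

(** * Machines for bracketed lists of items *)

Section ListMachine.
Variables (Sig O O' T : finType) (U : Type) (valid : U -> Prop).
Variables (word : U -> seq Sig) (val : U -> O) (B : machine Sig O) (lb rb : Sig).
Variables (e : T) (ext : O -> T -> T) (fin : T -> option O').

Definition feed (t : T) (d : mstate B) : bool + (O' + T * option (mstate B)) :=
  if mout d is Some o then inr (inr (ext o t, None)) else inr (inr (t, Some d)).

(* [inl true] is the start, [inl false] the sink, [inr (inl o)] the end;
   [inr (inr (t, x))] has read items of value [t], and [x] runs on the next one. *)
Definition list_step (c : Sig) (x : bool + (O' + T * option (mstate B))) :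
    bool + (O' + T * option (mstate B)) :=
  match x with
  | inl b => if b && (c == rb) then inr (inr (e, None)) else inl false
  | inr (inl _) => inl false
  | inr (inr (t, None)) =>
      if c == lb then (if fin t is Some o then inr (inl o) else inl false)
      else feed t (mstep c (mstart B))
  | inr (inr (t, Some d)) => feed t (mstep c d)
  end.

Definition list_machine : machine Sig O' :=
  @Machine Sig O' (bool + (O' + T * option (mstate B)))%type (inl true) list_step
    (fun x => if x is inr (inl o) then Some o else None).

Definition list_word (l : seq U) : seq Sig := lb :: rcons (flatten (map word l)) rb.
Definition list_val (l : seq U) : T := foldr (fun u => ext (val u)) e l.

Hypothesis BP : recognizes valid word val B.
Hypothesis word_last : forall u, valid u -> exists v c, word u = rcons v c /\ c != lb.

(** By [rec_code] no proper nonempty suffix of an item word has an output, so [feed] resets only at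
    the first letter. The last letter differs from [lb], so it is not taken for the opening bracket
    of the list. *)
Lemma list_step_item t u : valid u ->
  foldr list_step (inr (inr (t, None))) (word u) = inr (inr (ext (val u) t, None)).
Proof.
move=> uV; have [v [c [wE cN]]] := word_last uV.
have out_u := rec_complete BP uV; rewrite wE /mrun foldr_rcons in out_u *.
have run y : (exists x, mout (foldr (mstep (m:=B)) (mstep c (mstart B)) (x ++ y))) ->
    foldr list_step (feed t (mstep c (mstart B))) y =
    feed t (foldr (mstep (m:=B)) (mstep c (mstart B)) y).
  elim: y => [//|a y IH] [x xP] /=.
  rewrite IH; last by exists (rcons x a); rewrite cat_rcons.
  rewrite {1}/feed; case E: (mout _) => [o|//].
  by rewrite foldr_cat /= (rec_code BP) // E in xP.
rewrite foldr_rcons /= (negPf cN) run; last by exists [::]; rewrite /= out_u.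
by rewrite /feed out_u.
Qed.

Lemma list_machine_complete l o :
  List.Forall valid l -> fin (list_val l) = Some o ->
  mout (mrun list_machine (list_word l)) = Some o.
Proof.
move=> lV finE; rewrite /mrun /list_word /= foldr_rcons /= eqxx.
suff -> : foldr list_step (inr (inr (e, None))) (flatten (map word l))
    = inr (inr (list_val l, None)) by rewrite /= eqxx finE.
elim: l lV {finE} => [//|u l IH] lV /=.
by rewrite foldr_cat IH ?list_step_item //; inversion lV.
Qed.

Lemma list_machine_sound w o :
  mout (mrun list_machine w) = Some o ->
  exists2 l, List.Forall valid l & w = list_word l /\ fin (list_val l) = Some o.
Proof.
(* While items are being read, the part read so far is an unfinished item [y], then complete items
   [l], then [rb]. *)
have inv : match mrun list_machine w return Prop with
  | inl b => b -> w = [::]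
  | inr (inl o) =>
      exists2 l, List.Forall valid l & w = list_word l /\ fin (list_val l) = Some o
  | inr (inr (t, x)) => exists2 l, List.Forall valid l & t = list_val l /\
      exists2 y, w = y ++ rcons (flatten (map word l)) rb &
        if x is Some d then d = mrun B y else y = [::]
  end.
  have feedP t d c y l w' : List.Forall valid l -> t = list_val l ->
      w' = y ++ rcons (flatten (map word l)) rb -> d = mrun B y ->
      match feed t (mstep c d) return Prop with
      | inr (inr (t, x)) => exists2 l, List.Forall valid l & t = list_val l /\
        exists2 y, c :: w' = y ++ rcons (flatten (map word l)) rb &
        if x is Some d then d = mrun B y else y = [::]
      | _ => False
      end.
    move=> lV tE wE dE; rewrite /feed; case E: (mout _) => [o'|]; last first.
      by exists l => //; split=> //; exists (c :: y); rewrite ?wE ?dE.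
    have outE : mout (mrun B (c :: y)) = Some o' by rewrite /= -dE.
    have [u uV yE] := rec_sound BP outE.
    exists (u :: l); first by constructor.
    split; last by exists [::] => //=; rewrite wE -cat_cons yE rcons_cat.
    by move: outE; rewrite yE (rec_complete BP uV) tE => -[<-].
  elim: w => [//|c w] /=.
  case: (mrun list_machine w) => [b|[o'|[t [d|]]]] //=.
  - case: b => //= wE; case: eqP => //= cE.
    by exists [::] => //; split=> //; exists [::] => //; rewrite wE // cE.
  - case=> l lV [tE [y wE dE]].
    by move: (feedP t d c y l w lV tE wE dE); case: (feed _ _) => [|[|[]]].
  - case=> l lV [tE [y wE yE]]; rewrite yE /= in wE; case: eqP => [cE|_].
      case E: (fin t) => [o'|//]; exists l => //.
      by rewrite /list_word cE wE -tE E.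
    by move: (feedP t (mstart B) c [::] l w lV tE wE erefl); case: (feed _ _) => [|[|[]]].
move: inv; case: (mrun list_machine w) => [//|[o'|//]] /= inv [<-].
exact: inv.
Qed.

Lemma list_machine_code (d : mstate list_machine) c w :
  mout d -> mout (foldr (mstep (m:=list_machine)) (mstep c d) w) = None.
Proof.
case: d => [//|[o|//]] _ /=.
by suff -> : foldr list_step (inl false) w = inl false by []; elim: w => //= ? ? ->.
Qed.

End ListMachine.

(** [None] is the start, [Some None] the sink. *)
Definition letter_machine (G : finType) : machine (salph G) G :=
  @Machine (salph G) G (option (option G)) None
    (fun c d => match d, c with None, inl a => Some (Some a) | _, _ => Some None end)
    (fun d => if d is Some x then x else None).

Lemma letter_machineP (G : finType) :
  recognizes (fun _ : G => True) (fun a => [:: inl a]) id (letter_machine G).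
Proof.
have sink w : foldr (mstep (m:=letter_machine G)) (Some None) w = Some None by elim: w => //= c w ->.
split=> //=; last by case=> [[a|]|] //= c w _; rewrite sink.
elim/last_ind => [//|w c _] a; rewrite /mrun foldr_rcons /=.
case: c => [b|b]; last by rewrite sink.
case/lastP: w => [|w c] /=; first by exists b.
by rewrite foldr_rcons /= sink.
Qed.

(** * Words of stores, and operations split by level *)

Lemma sword_Sn (G : finType) (l : seq (store G)) :
  sword (Sn l) = list_word (sword (G:=G)) (LB G) (RB G) l.
Proof. by rewrite /list_word /=; congr (_ :: rcons _ _); elim: l => //= t l ->. Qed.

Lemma sword_S1 (G : finType) (l : seq G) :
  sword (S1 l) = list_word (fun a => [:: inl a]) (LB G) (RB G) l.
Proof. by rewrite /list_word /=; congr (_ :: rcons _ _); elim: l => //= t l ->. Qed.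

Lemma is_store_Sn (G : Type) n (l : seq (store G)) :
  is_store n.+2 (Sn l) <-> l <> [::] /\ List.Forall (is_store n.+1) l.
Proof.
rewrite /=; split=> -[lN lV]; split=> // {lN}; elim: l lV => //= t l IH.
  by case=> tV lV; constructor; [|exact: IH].
by move=> lV; split; [|apply: IH]; inversion lV.
Qed.

Lemma sword_last (G : finType) n (s : store G) :
  is_store n s -> exists v c, sword s = rcons v c /\ c != LB G.
Proof.
case: s => [l|l] _; [rewrite sword_S1|rewrite sword_Sn];
by rewrite /list_word -rcons_cons; do 2!eexists; split; first by [].
Qed.

Definition apply_act (G : Type) (n : nat) (o : option (op G)) (s : store G) :
    option (store G) :=
  if o is Some o then apply_op n o s else Some s.

Definition is_dup (G : Type) n (o : op G) := if o is Push k then k == n else false.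
Definition is_drop (G : Type) n (o : op G) := if o is Pop k then k == n else false.

Lemma apply_op_Sn (G : Type) n (o : op G) (u : store G) r :
  apply_op n.+2 o (Sn (u :: r)) =
    if is_dup n.+2 o then Some (Sn (u :: u :: r))
    else if is_drop n.+2 o then (if r is [::] then None else Some (Sn r))
    else omap (fun u' => Sn (u' :: r)) (apply_op n.+1 o u).
Proof. by case: o => [w|k|k] //=; case: (k == _); case: r. Qed.

Lemma is_store_apply_op (G : Type) n (o : op G) (s s' : store G) :
  is_store n.+1 s -> apply_op n.+1 o s = Some s' -> is_store n.+1 s'.
Proof.
elim: n s s' => [|n IH] s s'.
  by case: s => [[|a l]|//] _; case: o => [w|k|k] //=; first [by case=> <- | by case: (k == 1)].
case: s => [//|[|u r]] /is_store_Sn[//] _ sV.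
have [uV rV] : is_store n.+1 u /\ List.Forall (is_store n.+1) r by inversion sV.
rewrite apply_op_Sn; case: is_dup => [[<-]|].
  by apply/is_store_Sn; split=> //; do 2!constructor=> //.
case: is_drop.
  by case: r rV {sV} => // v r rV [<-]; apply/is_store_Sn.
case E: (apply_op _ _ _) => [u'|//] /= [<-].
by apply/is_store_Sn; split=> //; constructor=> //; exact: IH E.
Qed.

(** * Alternating systems over stores and their least solutions *)

Section Alternating.
Variables (G M : finType) (h : seq (salph G) -> M) (mul : M -> M -> M).
Hypothesis h_cat : forall u v, h (u ++ v) = mul (h u) (h v).

(* [delta p a v] is a monotone condition on the set [v] of pairs (control, operation)
   whose conjunction justifies adding [p] at a store with top letter [a];
   [None] is the operation leaving the store unchanged. *)
Record asystem := ASystem {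
  ctl : finType;
  base : ctl -> M -> bool;
  delta : ctl -> G -> (ctl -> option (op G) -> bool) -> bool;
  delta_mono p a (v v' : ctl -> option (op G) -> bool) :
    (forall q o, v q o -> v' q o) -> delta p a v -> delta p a v' }.

Record closed n (S : asystem) (Z : ctl S -> store G -> Prop) : Prop := {
  closed_base p s : is_store n s -> base p (h (sword s)) -> Z p s;
  closed_step p s a (v : ctl S -> option (op G) -> bool) :
    is_store n s -> top1 s = Some a -> delta p a v ->
    (forall q o, v q o -> exists2 s', apply_act n o s = Some s' & Z q s') -> Z p s }.

(** Minimality ranges over [Prop]-valued families, so that reachability itself can serve as [Z]. *)
Record solution n (S : asystem) := Solution {
  typ : store G -> {set ctl S};
  typ_closed : closed n (fun p s => p \in typ s);
  typ_least Z : closed n Z -> forall s, is_store n s -> forall p, p \in typ s -> Z p s;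
  typ_machine : machine (salph G) {set ctl S};
  typ_machineP : recognizes (is_store n) (sword (G:=G)) typ typ_machine }.

(** * Level 1: a fixpoint in a finite powerset *)

Section Level1.
Variable S : asystem.
Notation T := (M * {set ctl S})%type.
Implicit Types (W : {set ctl S * T * G}) (t : T).

(* Closing upward in the second component makes [step1] monotone. *)
Definition holds W p a t :=
  [exists Y : {set ctl S}, (Y \subset t.2) && ((p, (t.1, Y), a) \in W)].

Definition ext1 W a t : T := (mul (h [:: inl a]) t.1, [set p | holds W p a t]).

(** Here [t] is the type of the letters below the top letter [a], on which [Push1 w] puts [w] in
    place of [a]. *)
Definition act1 W a t (q : ctl S) (o : option (op G)) : bool :=
  match o with
  | None => holds W q a t
  | Some (Push1 w) => q \in (foldr (ext1 W) t w).2
  | _ => false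
  end.

Definition step1 W : {set ctl S * T * G} :=
  [set x | let: (p, t, a) := x in
     base p (mul (h [:: LB G]) (mul (h [:: inl a]) t.1)) || delta p a (act1 W a t)].

(** The empty 1-store has no top letter, so only [base] can put it in a component. *)
Definition bot1 : T :=
  (h [:: RB G], [set p | base p (mul (h [:: LB G]) (h [:: RB G]))]).

Lemma holds_mono W W' p a t t' :
  W \subset W' -> t.1 = t'.1 -> t.2 \subset t'.2 -> holds W p a t -> holds W' p a t'.
Proof.
move=> WW' e1 s2 /existsP[Y /andP[Yt YW]]; apply/existsP; exists Y.
by rewrite (subset_trans Yt) // (subsetP WW') -?e1.
Qed.

(** [W] also determines the types along a pushed word, so enlarging it changes the triples looked
    up; the upward closure in [holds] absorbs this. *)
Lemma step1_mono : {homo step1 : W W' / W \subset W'}.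
Proof.
move=> W W' WW'; apply/subsetP => -[[p t] a]; rewrite !inE => /orP[->//|D].
apply/orP; right; apply: delta_mono D => q [[w|//|//]|]; last exact: holds_mono.
suff [_ /subsetP/(_ q)//] : (foldr (ext1 W) t w).1 = (foldr (ext1 W') t w).1 /\
  (foldr (ext1 W) t w).2 \subset (foldr (ext1 W') t w).2.
elim: w => [//|b w [e1 s2]] /=; rewrite e1; split=> //.
by apply/subsetP => r; rewrite !inE; exact: holds_mono.
Qed.

Definition sol1 : {set ctl S * T * G} := fixset step1.
Definition typ1 (s : store G) : {set ctl S} :=
  if s is S1 w then (foldr (ext1 sol1) bot1 w).2 else set0.

Lemma holds_sol1 p a t : ((p, t, a) \in sol1) -> holds sol1 p a t.
Proof. by case: t => m Y tW; apply/existsP; exists Y; rewrite subxx. Qed.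

Lemma foldr_ext1_fst w : (foldr (ext1 sol1) bot1 w).1 = h (rcons (map inl w) (RB G)).
Proof. by elim: w => //= a w ->; rewrite -h_cat. Qed.

Lemma typ1_closed : closed 1 (fun p s => p \in typ1 s).
Proof.
have mem_sol1 x : (x \in sol1) = (x \in step1 sol1) by rewrite /sol1 fixsetK //; exact: step1_mono.
split=> p [w|//] => [_|a v _].
  case: w => [|a w] /= bP; first by rewrite inE /bot1 -h_cat.
  rewrite inE; apply: holds_sol1; rewrite mem_sol1 inE foldr_ext1_fst -!h_cat /=.
  by rewrite bP.
case: w => [//|b w] [->] {b} D vP.
rewrite inE; apply: holds_sol1; rewrite mem_sol1 inE; apply/orP; right.
apply: delta_mono D => q [[x|k|k]|] /vP[s' /=].
- by case=> <-; rewrite /= foldr_cat.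
- by case: (k == 1).
- by case: (k == 1).
- by case=> <-; rewrite /= inE.
Qed.

(** Induction on the iterates of the fixpoint: each triple is sound for [Z] on all tails compatible
    with its type, where [t.2] need only be a lower bound for the controls that [Z] gives the
    tail. *)
Lemma typ1_least Z : closed 1 Z -> forall s, is_store 1 s -> forall p, p \in typ1 s -> Z p s.
Proof.
move=> cZ.
pose compat t w := t.1 = h (rcons (map inl w) (RB G)) /\ forall q, q \in t.2 -> Z q (S1 w).
pose sound W := forall p t a w, (p, t, a) \in W -> compat t w -> Z p (S1 (a :: w)).
have holdsP W p a t w : sound W -> holds W p a t -> compat t w -> Z p (S1 (a :: w)).
  move=> sW /existsP[Y /andP[/subsetP Yt YW]] [e1 Zt].
  by apply: sW YW _; split=> // q /Yt/Zt.
have extP W w t w0 : sound W -> compat t w0 -> compat (foldr (ext1 W) t w) (w ++ w0).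
  move=> sW tw0; elim: w => [//|a w IH]; split=> /=.
    by rewrite IH.1 -h_cat.
  by move=> q; rewrite inE => /holdsP; apply.
have sound_sol1 : sound sol1.
  rewrite /sol1 /fixset; elim: #|_| => [|k IH] /=; first by move=> p t a w; rewrite inE.
  move: (iter k _ _) IH => W sW p t a w; rewrite inE => /orP[bP|D] tw.
    by apply: (closed_base cZ) => //=; rewrite tw.1 -!h_cat in bP.
  apply: (closed_step cZ (a := a) _ _ D) => // q [[x|//|//]|] /= vP; last first.
    by eexists; first by []; exact: holdsP vP tw.
  eexists; first by [].
  exact: (extP W x t w sW tw).2.
case=> [w|//] _ p /= pw.
have := (extP sol1 w bot1 [::] sound_sol1); rewrite cats0; case=> [|_]; last exact.
by split=> //= q; rewrite inE -h_cat => bP; exact: (closed_base cZ).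
Qed.

Definition machine1 : machine (salph G) {set ctl S} :=
  list_machine (letter_machine G) (LB G) (RB G) bot1 (ext1 sol1) (fun t => Some t.2).

Lemma machine1P : recognizes (is_store 1) (sword (G:=G)) typ1 machine1.
Proof.
have lastP (a : G) : True -> exists v c, [:: inl a] = rcons v c /\ c != LB G.
  by exists [::], (inl a).
split; last exact: list_machine_code.
  case=> [w|//] _; rewrite sword_S1.
  apply: (list_machine_complete _ (letter_machineP G) lastP) => //.
  by elim: w => // a w IH; constructor.
move=> w o /(list_machine_sound (letter_machineP G))[l _ [wE _]].
by exists (S1 l) => //; rewrite sword_S1.
Qed.

Definition solution1 : solution 1 S := Solution typ1_closed typ1_least machine1P.

End Level1.

(** * Passing from level n+1 to level n+2 *)

Section LevelSucc.
Variables (n : nat) (S : asystem).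
Notation T := (M * {set ctl S})%type.

(* Control [inl (p, t)]: the store, put on top of a sequence of stores of type [t], is
   in the component [p]; control [inr m]: the word of the store evaluates to [m]. *)
Definition down_ctl : finType := (ctl S * T + M)%type.

Definition down_base (c : down_ctl) (m : M) : bool :=
  match c with
  | inl (p, t) => base p (mul (h [:: LB G]) (mul m t.1))
  | inr m' => m == m'
  end.

(** On a push, [m] guesses the value of the word of the top item and [Y] the controls of the store
    below the new copy. A [Y] that is too small is harmless, since controls are used only
    positively. *)
Definition down_act (v : down_ctl -> option (op G) -> bool) (t : T) (q : ctl S)
    (o : option (op G)) : bool :=
  match o with
  | None => v (inl (q, t)) None
  | Some o =>
    if is_dup n.+2 o then
      [exists m : M, exists Y : {set ctl S},
         [&& v (inr m) None, v (inl (q, (mul m t.1, Y))) None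
           & [forall y in Y, v (inl (y, t)) None]]]
    else if is_drop n.+2 o then q \in t.2
    else v (inl (q, t)) (Some o)
  end.

Definition down_delta (c : down_ctl) a v : bool :=
  if c is inl (p, t) then delta p a (down_act v t) else false.

Lemma down_delta_mono c a (v v' : down_ctl -> option (op G) -> bool) :
  (forall q o, v q o -> v' q o) -> down_delta c a v -> down_delta c a v'.
Proof.
move=> vv'; case: c => //= -[p t]; apply: delta_mono => q [o|] /=; last exact: vv'.
case: is_dup; last by case: is_drop => //; exact: vv'.
case/existsP => m /existsP[Y /and3P[v1 v2 /forall_inP v3]].
apply/existsP; exists m; apply/existsP; exists Y; rewrite !vv' //=.
by apply/forall_inP => y /v3/vv'.
Qed.

Definition down : asystem := ASystem down_base down_delta_mono.

Variable sol : solution n.+1 down.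

(** If [Y] is the type of a store, it contains exactly one [inr m] ([typ_inr]), so the default [t.1]
    is not reached. *)
Definition extS (Y : {set down_ctl}) (t : T) : T :=
  (if [pick m | inr m \in Y] is Some m then mul m t.1 else t.1,
   [set p | inl (p, t) \in Y]).
(** The empty sequence is no store here: with [set0], popping the last item never succeeds. *)
Definition botS : T := (h [:: RB G], set0).
Definition valS (l : seq (store G)) : T := foldr (fun u => extS (typ sol u)) botS l.
Definition typS (s : store G) : {set ctl S} := if s is Sn l then (valS l).2 else set0.

(** Controls [inr m] have a false [down_delta], so by minimality they enter through [down_base]
    alone. *)
Lemma typ_inr m u : is_store n.+1 u -> (inr m \in typ sol u) = (h (sword u) == m).
Proof.
move=> uV; apply/idP/eqP => [|<-]; last by apply: (closed_base (typ_closed sol)) => /=.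
pose Z (c : ctl down) s := if c is inr m then h (sword s) = m else True.
suff cZ : closed n.+1 Z by exact: (typ_least (Z := Z) cZ uV (p := inr m)).
by split=> [[?|m'] s _ /eqP|[?|m'] s a v] //=.
Qed.

Lemma extS_fst u t : is_store n.+1 u -> (extS (typ sol u) t).1 = mul (h (sword u)) t.1.
Proof.
move=> uV /=; case: pickP => [m|/(_ (h (sword u)))]; rewrite typ_inr // ?eqxx //.
by move/eqP->.
Qed.

Definition tail_word (l : seq (store G)) := rcons (flatten (map (sword (G:=G)) l)) (RB G).

Lemma tail_word_cons u l : tail_word (u :: l) = sword u ++ tail_word l.
Proof. by rewrite /tail_word /= rcons_cat. Qed.

Lemma valS_fst l : List.Forall (is_store n.+1) l -> (valS l).1 = h (tail_word l).
Proof.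
elim: l => // u l IH ulV; rewrite tail_word_cons h_cat /valS [foldr _ _ _]/=.
by rewrite extS_fst ?IH //; inversion ulV.
Qed.

Lemma mem_typS u l p : (p \in typS (Sn (u :: l))) = (inl (p, valS l) \in typ sol u).
Proof. by rewrite /= inE. Qed.

Lemma typS_closed : closed n.+2 (fun p s => p \in typS s).
Proof.
split=> p [//|[|u l]].
- by case/is_store_Sn.
- case/is_store_Sn=> _ ulV.
  rewrite sword_Sn mem_typS => bP; apply: (closed_base (typ_closed sol)).
    by inversion ulV.
  rewrite /= valS_fst; last by inversion ulV.
  by rewrite -!h_cat -tail_word_cons.
- by move=> a v /is_store_Sn[].
move=> a v /is_store_Sn[_ ulV].
have [uV lV] : is_store n.+1 u /\ List.Forall (is_store n.+1) l by inversion ulV.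
rewrite mem_typS => topE D vP.
(* The largest choice, all pairs that hold at [u]; monotonicity transfers [D] to it. *)
pose v' c o := if apply_act n.+1 o u is Some u' then c \in typ sol u' else false.
apply: (closed_step (typ_closed sol) (a := a) (v := v')) => //; last first.
  move=> c o; rewrite /v'; case: apply_act => // u' cu'; by exists u'.
apply: delta_mono D => q [o|] /vP[s']; last by case=> <-; rewrite mem_typS.
rewrite /apply_act apply_op_Sn /down_act.
case: is_dup => [[<-]|].
  (* The guesses are the true ones: the value of [u] and the controls of [u :: l]. *)
  rewrite mem_typS => qP; apply/existsP; exists (h (sword u)).
  apply/existsP; exists (valS (u :: l)).2.
  rewrite /v' /= typ_inr // eqxx -extS_fst // -surjective_pairing qP /=.
  by apply/forall_inP => y; rewrite inE.
case: is_drop => [|]; first by case: l ulV lV topE vP {v'} => // u' l _ _ _ _ [<-].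
case E: apply_op => [u'|//] [<-].
by rewrite mem_typS /v' /= E.
Qed.

(** [Z] is carried one level down: [Z'] at [inl (p, t)] asks for [Z p] on top of every sequence
    compatible with [t], and minimality of [sol] applies to [Z']. *)
Lemma typS_least Z :
  closed n.+2 Z -> forall s, is_store n.+2 s -> forall p, p \in typS s -> Z p s.
Proof.
move=> cZ.
(* The clause [l <> [::]] makes the pop defined once a control is found in [t.2]. *)
pose compat (t : T) l :=
  t.1 = h (tail_word l) /\ forall q, q \in t.2 -> l <> [::] /\ Z q (Sn l).
pose Z' (c : ctl down) u := match c with
  | inl (p, t) => forall l, List.Forall (is_store n.+1) l -> compat t l -> Z p (Sn (u :: l))
  | inr m => h (sword u) = m
  end.
have cZ' : closed n.+1 Z'.
  split=> [[[p t]|m] u uV /= bP|[[p t]|m] u a v uV topE //= D vP].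
  - move=> l lV [tE _]; apply: (closed_base cZ).
      by apply/is_store_Sn; split=> //; constructor.
    by rewrite sword_Sn /list_word -/(tail_word (u :: l)) -cat1s h_cat tail_word_cons h_cat -tE.
  - exact/eqP.
  - move=> l lV tl; apply: (closed_step cZ (a := a) _ _ D) => //.
      by apply/is_store_Sn; split=> //; constructor.
    have nop q t' : v (inl (q, t')) None -> Z' (inl (q, t')) u by move=> /vP[_ [<-]].
    move=> q [o|]; last by move=> /nop qP; eexists; [by []|exact: qP].
    rewrite /apply_act apply_op_Sn /down_act; case: is_dup.
      case/existsP => m /existsP[Y /and3P[/vP[_ [<-] /= mE] /nop qP /forall_inP YP]].
      eexists; first by [].
      apply: qP; first by constructor.
      split=> [|y /YP/nop yP] /=; last by split=> //; exact: yP.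
      by rewrite tail_word_cons h_cat mE tl.1.
    case: is_drop => [/tl.2[lN qP]|/vP[u' /= -> qP]].
      by exists (Sn l) => //; case: l lN {lV tl qP}.
    by exists (Sn (u' :: l)) => //; exact: qP.
have valP l : List.Forall (is_store n.+1) l -> compat (valS l) l.
  elim: l => [|u l IH] ulV; first by split=> // q; rewrite inE.
  have [uV lV] : is_store n.+1 u /\ List.Forall (is_store n.+1) l by inversion ulV.
  split; first exact: valS_fst.
  move=> q; rewrite inE => /(typ_least cZ' uV) qP; split=> //.
  by apply: qP => //; exact: IH.
by case=> [//|l] /is_store_Sn[_ lV] p /(valP l lV).2[].
Qed.

(** The Boolean records whether an item has been read, in order to reject the empty list. *)
Definition machineS : machine (salph G) {set ctl S} :=
  list_machine (typ_machine sol) (LB G) (RB G) (botS, false)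
    (fun Y (x : T * bool) => (extS Y x.1, true))
    (fun x : T * bool => if x.2 then Some x.1.2 else None).

Lemma machineSP : recognizes (is_store n.+2) (sword (G:=G)) typS machineS.
Proof.
have valE l : list_val (typ sol) (botS, false)
    (fun Y (x : T * bool) => (extS Y x.1, true)) l = (valS l, ~~ nilp l).
  by elim: l => //= u l ->.
have lastP := @sword_last G n.+1.
split; last exact: list_machine_code.
  case=> [//|l] /is_store_Sn[lN lV]; rewrite sword_Sn.
  apply: (list_machine_complete _ (typ_machineP sol) lastP) => //.
  by rewrite valE; case: l lN {lV}.
move=> w o /(list_machine_sound (typ_machineP sol))[l lV [wE]].
rewrite valE => lN; exists (Sn l); last by rewrite sword_Sn.
by apply/is_store_Sn; split=> //; case: l lN {lV wE}.
Qed.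

Definition solutionS : solution n.+2 S := Solution typS_closed typS_least machineSP.

End LevelSucc.

Fixpoint solve n (S : asystem) : solution n.+1 S :=
  match n with
  | 0 => solution1 S
  | n.+1 => solutionS (solve n (down n S))
  end.

End Alternating.

(** * The finite monoid of behaviours of an automaton *)

Section Behaviour.
Variables (Sig : finType) (A : nfa Sig).

Definition behaviour (w : seq Sig) : {ffun {set 'I_(nfa_size A)} -> {set 'I_(nfa_size A)}} :=
  [ffun X => foldl (nfa_step (A:=A)) X w].

Definition bcomp (f g : {ffun {set 'I_(nfa_size A)} -> {set 'I_(nfa_size A)}}) :
    {ffun {set 'I_(nfa_size A)} -> {set 'I_(nfa_size A)}} :=
  [ffun X => g (f X)].

Lemma behaviour_cat u v : behaviour (u ++ v) = bcomp (behaviour u) (behaviour v).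
Proof. by apply/ffunP => X; rewrite !ffunE foldl_cat. Qed.

Definition accepting (f : {ffun {set 'I_(nfa_size A)} -> {set 'I_(nfa_size A)}}) : bool :=
  [exists q in f (nfa_init A), q \in nfa_final A].

Lemma accepting_behaviour w : accepting (behaviour w) = nfa_accepts A w.
Proof. by rewrite /accepting ffunE. Qed.

End Behaviour.

(** * The system of an HCFP *)

Section PreStar.
Variables (G : finType) (H : hcfp G) (A : nfa (salph G)).

(** A rule asks for a single pair, so alternation arises only in [down]. *)
Definition hcfp_delta (p : unit) a (v : unit -> option (op G) -> bool) : bool :=
  List.existsb (fun r => (r.1 == a) && v tt (Some r.2)) H.

Lemma hcfp_delta_mono p a (v v' : unit -> option (op G) -> bool) :
  (forall q o, v q o -> v' q o) -> hcfp_delta p a v -> hcfp_delta p a v'.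
Proof.
move=> vv' /List.existsb_exists[r [rH /andP[ra rv]]].
by apply/List.existsb_exists; exists r; rewrite ra vv'.
Qed.

Definition hcfp_system : asystem G {ffun {set 'I_(nfa_size A)} -> {set 'I_(nfa_size A)}} :=
  ASystem (fun _ : unit => @accepting _ A) hcfp_delta_mono.

Definition pre_star_sol n := solve (@behaviour_cat _ A) n hcfp_system.

(** One direction is minimality against the family of stores that reach the target; the other is
    closedness, applied backwards along a run. *)
Lemma pre_star_solP n s : is_store n.+1 s ->
  tt \in typ (pre_star_sol n) s <-> pre_star n.+1 H (stores_of n.+1 A) s.
Proof.
move=> sV; have [cb cs] := typ_closed (pre_star_sol n); split=> [|[_ [s' [[s'V s'A] R]]]].
  pose Z (_ : ctl hcfp_system) s := pre_star n.+1 H (stores_of n.+1 A) s.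
  apply: (typ_least (Z := Z) _ sV (p := tt)); split=> [p t tV|p t a v tV topE].
    rewrite /= accepting_behaviour => tA; split=> //; exists t; split=> //.
    exact: hreach_refl.
  move=> /List.existsb_exists[[b o] [/= rH /andP[/eqP bE vo]]] /(_ _ _ vo)[t' oE [_ [s' [s'S R]]]].
  split=> //; exists s'; split=> //; apply: hreach_step R.
  by exists b, o; split=> //; rewrite topE bE.
elim: R sV s'V s'A => {s s'} [s|s s' s'' [a [o [rH [topE oE]]]] _ IH] sV s''V s''A.
  by apply: cb => //=; rewrite accepting_behaviour.
have s'P := IH (is_store_apply_op sV oE) s''V s''A.
apply: (cs tt s a (fun _ o' => if apply_act n.+1 o' s is Some t then tt \in typ (pre_star_sol n) t
  else false)) => // [|[] o']; last by case: apply_act => // t tP; exists t.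
apply/List.existsb_exists; exists (a, o); split=> //=.
by rewrite /apply_act oE eqxx.
Qed.

End PreStar.

Theorem theorem1 (G : finType) :
  { f : nat -> hcfp G -> nfa (salph G) -> nfa (salph G) |
    forall (n : nat) (H : hcfp G) (A : nfa (salph G)),
      0 < n -> hcfp_wf n H ->
      forall w : seq (salph G),
        nfa_accepts (f n H A) w <->
        exists s, w = sword s /\ pre_star n H (stores_of n A) s }.
Proof.
(* [pre_star_sol] with index k solves level k+1, hence [n.-1]. *)
exists (fun n H A =>
  machine_nfa (typ_machine (pre_star_sol H A n.-1)) (fun Y => tt \in Y)).
case=> // n H A _ _ w /=; rewrite machine_nfaP.
have BP := typ_machineP (pre_star_sol H A n); split.
  case E: mout => [Y|//] YP; have [s sV wE] := rec_sound BP E.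
  exists s; split=> //; apply/pre_star_solP => //.
  by move: E; rewrite wE (rec_complete BP sV) => -[->].
case=> s [-> sP]; have sV := sP.1.
by rewrite (rec_complete BP sV); apply/pre_star_solP.
Qed.
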